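(* Let $r>0$ and let $(X,d)$ be a metric space which is connected at scale $r$. Then $DH_{1,r}(X)$ is isomorphic to the abelianization of the discrete fundamental group $A_{1,r}(X)$ of $X$ at scale $r$.
   Context: **Connectedness at scale $r$.** $(X,d)$ is connected at scale $r$ if for all $x,y\in X$ there are $x_0,\dots,x_{n+1}\in X$ with $x_0=x$, $x_{n+1}=y$ and $d(x_i,x_{i+1})\le r$ for all $i$; such a sequence is called an $r$-path from $x$ to $y$. **Discrete fundamental group.** Fix $p\in X$. An $r$-loop based at $p$ is an $r$-path $x_0x_1\ldots x_{n+1}$ with $x_0=x_{n+1}=p$. Let $\mathcal C_r(X,p)$ be the set of $r$-loops based at $p$, with the operation of concatenation of sequences. Let $\sim_r$ be the equivalence relation generated by the following: (i) $x_0x_1\ldots x_{n+1}\sim_r x_0x_1\ldots x_{n+1}p$; (ii) two $r$-loops $x_0\ldots x_{n+1}$ and $y_0\ldots y_{n+1}$ of the same length are equivalent if there is a finite matrix of points of $X$ with first row $x_0,\dots,x_{n+1}$ and last row $y_0,\dots,y_{n+1}$ such that every row is an $r$-loop based at $p$ and every column is an $r$-path. Concatenation descends to a group structure on $A_{1,r}(X,p)=\mathcal C_r(X,p)/\sim_r$. If $X$ is connected at scale $r$, this group is independent of $p$ up to isomorphism and is denoted $A_{1,r}(X)$. **Discrete homology at scale $r$.** Let $Q_n=\{0,1\}^n$ with the Hamming distance. A singular $(n,r)$-cube in $X$ is an $r$-Lipschitz map $\sigma:Q_n\to X$, i.e. $d(\sigma(a),\sigma(b))\le r\,d_{Q_n}(a,b)$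 for all $a,b$. Let $L_{n,r}(X)$ be the free abelian group on the singular $(n,r)$-cubes. For $n\ge1$ and $1\le i\le n$ put $(A_i^n\sigma)(a_1,\dots,a_{n-1})=\sigma(a_1,\dots,a_{i-1},0,a_i,\dots,a_{n-1})$ and $(B_i^n\sigma)(a_1,\dots,a_{n-1})=\sigma(a_1,\dots,a_{i-1},1,a_i,\dots,a_{n-1})$. The cube $\sigma$ is degenerate if $A_i^n\sigma=B_i^n\sigma$ for some $i$. Let $D_{n,r}(X)$ be the subgroup generated by the degenerate cubes and $C_{n,r}(X)=L_{n,r}(X)/D_{n,r}(X)$. The boundary $\partial\sigma=\sum_{i=1}^n(-1)^i(A_i^n\sigma-B_i^n\sigma)$ induces $\partial_n:C_{n,r}(X)\to C_{n-1,r}(X)$, and $DH_{n,r}(X)=\ker\partial_n/\operatorname{Im}\partial_{n+1}$. *)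

(* Defs.v *)
From Stdlib Require Import Relation_Operators.
From HB Require Import structures.
From mathcomp Require Import freeg generic_quotient.
From mathcomp Require Import all_boot all_order all_algebra.
From mathcomp Require Import boolp classical_sets reals interval_inference.
From mathcomp Require Import topology metric_structure.

Set Implicit Arguments.
Unset Strict Implicit.
Unset Printing Implicit Defensive.

Import Order.TTheory GRing.Theory Num.Theory.

Local Open Scope ring_scope.
Local Open Scope quotient_scope.

Inductive zspan (V : zmodType) (S : set V) : V -> Prop :=
| zspan0 : zspan S 0
| zspan_gen x of S x : zspan S x
| zspanB x y of zspan S x & zspan S y : zspan S (x - y).

Section ZSpan.
Variables (V : zmodType) (S : set V).

Definition zspan_pred : {pred V} := fun x => `[< zspan S x >].

Lemma zspan_closed : zmod_closed zspan_pred.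
Proof.
split=> [|x y /asboolP xS /asboolP yS]; first exact/asboolP/zspan0.
exact/asboolP/zspanB.
Qed.

HB.instance Definition _ := GRing.isZmodClosed.Build V zspan_pred zspan_closed.

End ZSpan.

Inductive derived (G : groupType) : G -> Prop :=
| derived1 : derived 1%g
| derivedR x y : derived [~ x, y]%g
| derivedM x y of derived x & derived y : derived (x * y)%g
| derivedV x of derived x : derived x^-1%g.

Section Abelianization.
Variable G : groupType.
Local Open Scope group_scope.

Lemma derivedJ (x y : G) : derived x -> derived (x ^ y).
Proof.
move=> dx; have -> : x ^ y = x * [~ x, y] by rewrite mulVKg.
exact: derivedM (derivedR x y).
Qed.

Definition ab_equiv (x y : G) := `[< derived (x^-1 * y) >].

Lemma ab_equiv_is_equiv : equiv_class_of ab_equiv.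
Proof.
split=> [x|x y|y x z].
- by apply/asboolP; rewrite mulVg; apply: derived1.
- by apply/asboolP/asboolP => /derivedV; rewrite invgM invgK.
- move=> /asboolP xy /asboolP yz; apply/asboolP.
  by have := derivedM xy yz; rewrite -mulgA mulVKg.
Qed.

Canonical ab_equiv_equiv := EquivRelPack ab_equiv_is_equiv.
Canonical ab_equiv_encModRel := defaultEncModRel ab_equiv.

Definition abelianization := {eq_quot ab_equiv}.

HB.instance Definition _ : EqQuotient G ab_equiv abelianization :=
  EqQuotient.on abelianization.
HB.instance Definition _ := Choice.on abelianization.

Definition ab_one : abelianization := lift_cst abelianization 1.
Definition ab_mul := lift_op2 abelianization (fun x y : G => x * y).
Definition ab_inv := lift_op1 abelianization (fun x : G => x^-1).

Canonical pi_ab_one_morph := PiConst ab_one.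

Lemma ab_equivP (x y : G) :
  reflect (x = y %[mod abelianization]) `[< derived (x^-1 * y) >].
Proof. exact: eqmodP. Qed.

Lemma pi_ab_mul : {morph \pi : x y / x * y >-> ab_mul x y}.
Proof.
move=> x y; unlock ab_mul; apply/ab_equivP/asboolP.
have /ab_equivP/asboolP xx' : x = repr (\pi_abelianization x)
  %[mod abelianization] by rewrite reprK.
have /ab_equivP/asboolP yy' : y = repr (\pi_abelianization y)
  %[mod abelianization] by rewrite reprK.
move: (repr _) (repr _) xx' yy' => x' y' xx' yy'.
have := derivedM (derivedJ y xx') yy'.
by rewrite conjgE -!mulgA mulVKg invgM -!mulgA.
Qed.
Canonical pi_ab_mul_morph := PiMorph2 pi_ab_mul.

Lemma pi_ab_inv : {morph \pi : x / x^-1 >-> ab_inv x}.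
Proof.
move=> x; unlock ab_inv; apply/ab_equivP/asboolP.
have /ab_equivP/asboolP xx' : x = repr (\pi_abelianization x)
  %[mod abelianization] by rewrite reprK.
move: (repr _) xx' => x' xx'.
have := derivedV (derivedJ x^-1 xx').
by rewrite conjgE invgK -mulgA mulVKg invgM invgK.
Qed.
Canonical pi_ab_inv_morph := PiMorph1 pi_ab_inv.

Lemma ab_mulA : associative ab_mul.
Proof. by move=> x y z; rewrite -[x]reprK -[y]reprK -[z]reprK !piE mulgA. Qed.

Lemma ab_mul1 : left_id ab_one ab_mul.
Proof. by move=> x; rewrite -[x]reprK !piE mul1g. Qed.

Lemma ab_1mul : right_id ab_one ab_mul.
Proof. by move=> x; rewrite -[x]reprK !piE mulg1. Qed.

Lemma ab_mulV : left_inverse ab_one ab_inv ab_mul.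
Proof. by move=> x; rewrite -[x]reprK !piE mulVg. Qed.

Lemma ab_Vmul : right_inverse ab_one ab_inv ab_mul.
Proof. by move=> x; rewrite -[x]reprK !piE mulgV. Qed.

HB.instance Definition _ :=
  isGroup.Build abelianization ab_mulA ab_mul1 ab_1mul ab_mulV ab_Vmul.

End Abelianization.

Definition vertex n := {ffun 'I_n -> bool}.

Definition hamming n (a b : vertex n) : nat := #|[pred i | a i != b i]|.

(* Insertion of the coordinate [c] at position [i]; [n.-1] is used so that the
   faces, and later the boundary, are defined for every [n]. *)
Definition vinsert n (i : 'I_n) (c : bool) (a : vertex n.-1) : vertex n :=
  [ffun j => if fintype.unlift i j is Some k then a k else c].

Lemma vinsert_same n (i : 'I_n) c a : vinsert i c a i = c.
Proof. by rewrite ffunE unlift_none. Qed.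

Lemma vinsert_lift n (i : 'I_n) c a k :
  vinsert i c a (fintype.lift i k) = a k.
Proof. by rewrite ffunE liftK. Qed.

Lemma hamming_vinsert n (i : 'I_n) c (a b : vertex n.-1) :
  hamming (vinsert i c a) (vinsert i c b) = hamming a b.
Proof.
rewrite /hamming -[RHS](card_image (@lift_inj _ i)); apply: eq_card => j.
apply/idP/idP => [|/fintype.imageP[k abk ->]]; last by rewrite inE !vinsert_lift.
rewrite inE; have [k ->|->] := unliftP i j; last by rewrite !vinsert_same eqxx.
by rewrite !vinsert_lift => abk; apply/fintype.imageP; exists k.
Qed.

Section Homology.
Variables (R : realType) (X : metricType R) (r : {posnum R}).

Definition lipschitz n (s : {ffun vertex n -> X}) : bool :=
  [forall a, forall b, mdist (s a) (s b) <= r%:num * (hamming a b)%:R].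

Record cube n := Cube { cube_val :> {ffun vertex n -> X};
                        cubeP : lipschitz cube_val }.
HB.instance Definition _ n := [isSub for @cube_val n].
HB.instance Definition _ n := [Choice of cube n by <:].

Lemma face_lipschitz n (i : 'I_n) (c : bool) (s : cube n) :
  lipschitz [ffun a => s (vinsert i c a)].
Proof.
apply/forallP => a; apply/forallP => b; rewrite !ffunE.
have /forallP/(_ (vinsert i c a))/forallP/(_ (vinsert i c b)) := cubeP s.
by rewrite hamming_vinsert.
Qed.

(* [face i false] is A_i and [face i true] is B_i, with [i] counted from 0. *)
Definition face n (i : 'I_n) (c : bool) (s : cube n) : cube n.-1 :=
  Cube (face_lipschitz i c s).

Definition degenerate n (s : cube n) : Prop :=
  exists i, face i false s = face i true s.

Definition Lgrp n := {freeg (cube n) / int}.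

HB.instance Definition _ n := GRing.Lmodule.on (Lgrp n).

Definition gen n (s : cube n) : Lgrp n := << s >>.

(* The sign is (-1)^(i+1) because [i] is counted from 0; the sum is empty for
   [n = 0], so that the boundary of a 0-chain is 0. *)
Definition cube_boundary n (s : cube n) : Lgrp n.-1 :=
  \sum_(i < n) (-1) ^+ i.+1 *: (gen (face i false s) - gen (face i true s)).

Definition Lboundary n : Lgrp n -> Lgrp n.-1 := fglift (@cube_boundary n).

Lemma Lboundary_is_zmod_morphism n : zmod_morphism (@Lboundary n).
Proof. exact: lift_is_additive. Qed.

HB.instance Definition _ n := GRing.isZmodMorphism.Build (Lgrp n) (Lgrp n.-1)
  (@Lboundary n) (@Lboundary_is_zmod_morphism n).

Lemma Lboundary_gen n (s : cube n) : Lboundary (gen s) = cube_boundary s.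
Proof. by rewrite /Lboundary liftU scale1r. Qed.

Definition Dgrp n : {pred Lgrp n} :=
  @zspan_pred (Lgrp n) [set gen s | s in @degenerate n]%classic.

Lemma Lboundary_degenerate n (x : Lgrp n) :
  x \in @Dgrp n -> Lboundary x \in @Dgrp n.-1.
Proof.
move=> /asboolP; elim=> [|_ [s [j sj] <-]|y z _ IHy _ IHz].
- by rewrite raddf0 rpred0.
- rewrite Lboundary_gen; apply: rpred_sum => i _.
  have [<-|ji] := eqVneq j i; first by rewrite sj subrr scaler0 rpred0.
  (* s does not depend on the coordinate j *)
  have sE (a b : vertex n) : (forall k, k != j -> a k = b k) -> s a = s b.
    have insE (a' : vertex n) : vinsert j (a' j)
        [ffun k => a' (fintype.lift j k)] = a'.
      apply/ffunP => k; have [k' ->|->] := unliftP j k.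
        by rewrite vinsert_lift ffunE.
      by rewrite vinsert_same.
    have sjE c a' : s (vinsert j c a') = s (vinsert j true a').
      have /(congr1 (fun t : cube n.-1 => t a')) := sj.
      by rewrite !ffunE; case: c.
    move=> ab; rewrite -(insE a) -(insE b) sjE [RHS]sjE; congr (s (vinsert _ _ _)).
    by apply/ffunP => k; rewrite !ffunE ab// eq_sym neq_lift.
  have [j' jE|jE] := unliftP i j; last by rewrite jE eqxx in ji.
  have Df c : gen (face i c s) \in @Dgrp n.-1.
    apply/asboolP/zspan_gen; exists (face i c s) => //; exists j'.
    apply/val_inj/ffunP => a; rewrite !ffunE; apply: sE => k kj.
    have [k' kE|->] := unliftP i k; last by rewrite !vinsert_same.
    rewrite kE !vinsert_lift; have [k'' kE'|kE'] := unliftP j' k'.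
      by rewrite kE' !vinsert_lift.
    by rewrite kE kE' -jE eqxx in kj.
  by rewrite -signr_odd scaler_sign; case: ifP => _; rewrite ?rpredN rpredB.
- by rewrite raddfB rpredB.
Qed.

Definition Cgrp n := {ideal_quot @Dgrp n}.

HB.instance Definition _ n := GRing.Zmodule.on (Cgrp n).

(* Independent of the representative by [boundary_pi]. *)
Definition boundary n (x : Cgrp n) : Cgrp n.-1 :=
  \pi_(Cgrp n.-1) (Lboundary (repr x)).

Lemma Dgrp_eqP n (x y : Lgrp n) :
  reflect (x = y %[mod Cgrp n]) (x - y \in @Dgrp n).
Proof. by rewrite Quotient.idealrBE; apply: eqP. Qed.

Lemma boundary_pi n (x : Lgrp n) :
  boundary (\pi_(Cgrp n) x) = \pi_(Cgrp n.-1) (Lboundary x).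
Proof.
apply/Dgrp_eqP; rewrite -raddfB; apply/Lboundary_degenerate/Dgrp_eqP.
by rewrite reprK.
Qed.

Lemma boundary_is_zmod_morphism n : zmod_morphism (@boundary n).
Proof.
move=> x y; rewrite -[x]reprK -[y]reprK -[in LHS]raddfB !boundary_pi.
by rewrite -raddfB -[in RHS]raddfB.
Qed.

HB.instance Definition _ n := GRing.isZmodMorphism.Build (Cgrp n) (Cgrp n.-1)
  (@boundary n) (@boundary_is_zmod_morphism n).

Definition cycle_pred n : {pred Cgrp n} := fun x => boundary x == 0.

Lemma cycle_closed n : zmod_closed (@cycle_pred n).
Proof.
split=> [|x y /eqP x0 /eqP y0]; first by apply/eqP; rewrite raddf0.
by apply/eqP; rewrite raddfB /= x0 y0 subrr.
Qed.

HB.instance Definition _ n :=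
  GRing.isZmodClosed.Build (Cgrp n) (@cycle_pred n) (@cycle_closed n).

Record Zgrp n := Cycle { cycle_val :> Cgrp n;
                         cycleP : cycle_val \in @cycle_pred n }.
HB.instance Definition _ n := [isSub for @cycle_val n].
HB.instance Definition _ n := [Choice of Zgrp n by <:].
HB.instance Definition _ n := [SubChoice_isSubZmodule of Zgrp n by <:].

(* The image of the boundary from [Cgrp n.+1], as a subgroup of the cycles. *)
Definition Bgrp n : {pred Zgrp n} :=
  fun z => `[< exists c : Cgrp n.+1, boundary c = cycle_val z >].

Lemma Bgrp_closed n : zmod_closed (@Bgrp n).
Proof.
split=> [|x y /asboolP[c cx] /asboolP[d dy]].
  by apply/asboolP; exists 0; rewrite raddf0.
by apply/asboolP; exists (c - d); rewrite raddfB /= cx dy.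
Qed.

HB.instance Definition _ n :=
  GRing.isZmodClosed.Build (Zgrp n) (@Bgrp n) (@Bgrp_closed n).

Definition DH n := {ideal_quot @Bgrp n}.

HB.instance Definition _ n := GRing.Zmodule.on (DH n).

End Homology.

Section FundamentalGroup.
Variables (R : realType) (X : metricType R) (r : {posnum R}).

Definition near_at : rel X := fun x y => mdist x y <= r%:num.

Definition is_rpath (s : seq X) : bool := (1 < size s)%N && sorted near_at s.

(* The default values of [head] and [last] are irrelevant, as the length of an
   r-path is at least 2. *)
Definition rpath_between (x y : X) (s : seq X) : bool :=
  [&& is_rpath s, head y s == x & last x s == y].

Definition connected_at_scale : Prop :=
  forall x y : X, exists s, rpath_between x y s.

Variable p : X.

Definition is_loop (s : seq X) : bool := rpath_between p p s.

Record loop := Loop { loop_val :> seq X; loopP : is_loop loop_val }.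
HB.instance Definition _ := [isSub for loop_val].
HB.instance Definition _ := [Choice of loop by <:].

Inductive loop_step (s t : loop) : Prop :=
| loop_pad of loop_val t = rcons s p
| loop_grid m n (M : 'M[X]_(m.+1, n))
    of loop_val s = codom (M ord0)
     & loop_val t = codom (M ord_max)
     & (forall i, is_loop (codom (M i)))
     & (forall j, is_rpath (codom (M^~ j))).

Definition loop_equiv (s t : loop) : bool :=
  `[< clos_refl_sym_trans loop loop_step s t >].

Lemma loop_equiv_is_equiv : equiv_class_of loop_equiv.
Proof.
split=> [s|s t|t s u].
- exact/asboolP/rst_refl.
- by apply/asboolP/asboolP; apply: rst_sym.
- by move=> /asboolP st /asboolP tu; exact/asboolP/(rst_trans _ _ _ _ _ st tu).
Qed.

Canonical loop_equiv_equiv := EquivRelPack loop_equiv_is_equiv.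
Canonical loop_equiv_encModRel := defaultEncModRel loop_equiv.

Lemma near_at_refl : reflexive near_at.
Proof. by move=> x; rewrite /near_at mdistxx. Qed.

Lemma near_at_sym : symmetric near_at.
Proof. by move=> x y; rewrite /near_at metric_sym. Qed.

#[local] Hint Resolve near_at_refl : core.

Lemma is_loopE s : is_loop s =
  [&& (1 < size s)%N, sorted near_at s, head p s == p & last p s == p].
Proof. by rewrite /is_loop /rpath_between /is_rpath -!andbA. Qed.

Lemma loop_cat_subproof (s t : loop) : is_loop (s ++ t).
Proof.
case: s t => s + [t]; rewrite /= !is_loopE.
case: s => // x s /and4P[_ /= ss /= /eqP xp /eqP ls]; rewrite {}xp in ss ls *.
case: t => // y t /and4P[_ /= st /= /eqP yp /eqP lt]; rewrite {}yp in st lt *.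
by rewrite last_cat /= lt !eqxx size_cat addnS /= cat_path ss ls /= near_at_refl st.
Qed.

Definition loop_cat (s t : loop) := Loop (loop_cat_subproof s t).

Lemma loop_rev_subproof (s : loop) : is_loop (rev s).
Proof.
case: s => s; rewrite /= !is_loopE size_rev => /and4P[-> ss hs ls] /=.
rewrite rev_sorted (@eq_sorted _ _ near_at) ?ss; last first.
  by move=> x y; rewrite near_at_sym.
case: s {ss} hs ls => [|x s]; first by rewrite /rev /= eqxx.
case/lastP: s => [|s y] /= hs.
  by rewrite /rev /= => ->.
by rewrite rev_cons rev_rcons !last_rcons /= => ->.
Qed.

Definition loop_rev (s : loop) := Loop (loop_rev_subproof s).

Lemma loop_one_subproof : is_loop [:: p; p].
Proof. by rewrite is_loopE /= near_at_refl !eqxx. Qed.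

Definition loop_one := Loop loop_one_subproof.

Definition seq_equiv (s t : seq X) : Prop :=
  exists u v : loop, [/\ loop_val u = s, loop_val v = t & loop_equiv u v].

Lemma seq_equivP (s t : loop) : reflect (seq_equiv s t) (loop_equiv s t).
Proof.
apply: (iffP idP) => [st|[u [v [+ + uv]]]]; first by exists s, t.
by move=> /val_inj <- /val_inj <-.
Qed.

Lemma seq_equiv_refl s : is_loop s -> seq_equiv s s.
Proof. by move=> ls; exists (Loop ls), (Loop ls); split=> //; apply: equiv_refl. Qed.

Lemma seq_equiv_sym s t : seq_equiv s t -> seq_equiv t s.
Proof. by move=> [u [v [us vt uv]]]; exists v, u; split=> //; rewrite equiv_sym. Qed.

Lemma seq_equiv_trans t s u : seq_equiv s t -> seq_equiv t u -> seq_equiv s u.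
Proof.
move=> [s' [t' [<- <- st]]] [t'' [u' [/val_inj -> <- tu]]].
by exists s', u'; split=> //; apply: equiv_trans tu.
Qed.

Lemma is_loop_rcons s : is_loop s -> is_loop (rcons s p).
Proof.
rewrite !is_loopE; case: s => // x s /and4P[_ /= ss -> /eqP ls].
by rewrite size_rcons last_rcons rcons_path ss ls near_at_refl eqxx.
Qed.

Lemma seq_equiv_rcons s : is_loop s -> seq_equiv s (rcons s p).
Proof.
move=> ls; exists (Loop ls), (Loop (is_loop_rcons ls)); split=> //.
by apply/asboolP/rst_step/loop_pad.
Qed.

Lemma seq_equiv_near s t : is_loop s -> is_loop t -> all2 near_at s t ->
  seq_equiv s t.
Proof.
move=> ls lt; rewrite all2E => /andP[/eqP st /allP near_st].
exists (Loop ls), (Loop lt); split=> //; apply/asboolP/rst_step.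
have seqE u : size u = size s ->
    u = codom (fun j : 'I_(size s) => nth p u j).
  move=> us; rewrite codomE (map_comp (nth p u)) val_enum_ord -us.
  by rewrite -/(mkseq _ _) mkseq_nth.
pose M : 'M[X]_(2, size s) :=
  \matrix_(i, j) if i == ord0 then nth p s j else nth p t j.
have M0 : codom (M ord0) = s.
  by rewrite [RHS]seqE//; apply: eq_codom => j; rewrite mxE.
have M1 : codom (M ord_max) = t.
  by rewrite [RHS]seqE -?st//; apply: eq_codom => j; rewrite mxE.
apply: (loop_grid (M := M)) => //= [i|j].
  have [->|] := eqVneq i ord0; first by rewrite M0.
  case: i => -[|[|//]] //= i2 _; rewrite (_ : Ordinal i2 = ord_max) ?M1//.
  exact/val_inj.
have -> : codom (M^~ j) = [:: M ord0 j; M ord_max j].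
  rewrite codomE (_ : enum 'I_2 = [:: ord0; ord_max])//.
  by apply: (inj_map val_inj); rewrite val_enum_ord.
rewrite /is_rpath /= !mxE /= andbT.
apply: (near_st (_, _)); rewrite -nth_zip//.
by apply: mem_nth; rewrite size_zip -st minnn.
Qed.

Lemma all2_near_refl s : all2 near_at s s.
Proof. by elim: s => //= x s ->; rewrite near_at_refl. Qed.

(* A grid is a finite chain of pointwise near loops. *)
Lemma loop_grid_ind (F : loop -> seq X) (s t : loop) :
  (forall u v : loop, all2 near_at u v -> seq_equiv (F u) (F v)) ->
  forall m n (M : 'M[X]_(m.+1, n)),
    loop_val s = codom (M ord0) -> loop_val t = codom (M ord_max) ->
    (forall i, is_loop (codom (M i))) -> (forall j, is_rpath (codom (M^~ j))) ->
  seq_equiv (F s) (F t).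
Proof.
move=> FE m n M sM tM rowM colM.
have sE : s = Loop (rowM ord0) by apply: val_inj.
have tE : t = Loop (rowM ord_max) by apply: val_inj.
have : forall k (km : (k < m.+1)%N),
    seq_equiv (F s) (F (Loop (rowM (Ordinal km)))).
  elim=> [km|k IHk km].
    rewrite sE (_ : Ordinal km = ord0); last exact: val_inj.
    exact/FE/all2_near_refl.
  apply: seq_equiv_trans (IHk (ltnW km)) _; apply: FE => /=.
  rewrite !codomE; elim: (enum 'I_n) => //= j e ->; rewrite andbT.
  have /andP[_ /(sortedP p)/(_ k)] := colM j.
  rewrite size_codom card_ord => /(_ km).
  have nthE l (lm : (l < m.+1)%N) : nth p (codom (M^~ j)) l = M (Ordinal lm) j.
    rewrite codomE (nth_map ord0) ?size_enum_ord//; congr (M _ j).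
    by apply: val_inj; rewrite /= nth_enum_ord.
  by rewrite (nthE _ (ltnW km)) (nthE _ km).
move=> /(_ m (ltnSn m)); rewrite tE.
by rewrite (_ : Ordinal _ = ord_max)//; apply: val_inj.
Qed.

Lemma loop_equiv_ind (F : loop -> seq X) (s t : loop) :
  (forall u v : loop, loop_val v = rcons u p -> seq_equiv (F u) (F v)) ->
  (forall u v : loop, all2 near_at u v -> seq_equiv (F u) (F v)) ->
  loop_equiv s t -> seq_equiv (F s) (F t).
Proof.
move=> Fpad Fnear /asboolP; elim=> {s t} [s t []|s|s t _|s t u _ IHst _].
- exact: Fpad.
- by move=> m n M; apply: loop_grid_ind.
- exact/Fnear/all2_near_refl.
- exact: seq_equiv_sym.
- exact: seq_equiv_trans.
Qed.

Lemma all2_near_shift x y s : path near_at x s -> near_at (last x s) y ->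
  all2 near_at (x :: s) (rcons s y).
Proof.
elim: s x => [|z s IHs] x /= => [_ ->//|/andP[-> zs] sy] /=.
exact: IHs.
Qed.

Lemma all2_near_shift_loop s : is_loop s ->
  all2 near_at (p :: s) (rcons s p).
Proof.
rewrite is_loopE; case: s => // x s /and4P[_ /= xs /eqP xp /eqP sp].
by apply: (@all2_near_shift p p (x :: s)); rewrite /= ?sp// -xp near_at_refl.
Qed.

Lemma all2_near_sym s t : all2 near_at s t -> all2 near_at t s.
Proof.
elim: s t => [|x s IHs] [|y t] //= /andP[xy /IHs ->].
by rewrite near_at_sym xy.
Qed.

Lemma all2_near_cat s1 t1 s2 t2 : all2 near_at s1 t1 -> all2 near_at s2 t2 ->
  all2 near_at (s1 ++ s2) (t1 ++ t2).
Proof.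
by elim: s1 t1 => [|x s1 IHs] [|y t1] //= /andP[-> /IHs st] /st ->.
Qed.

Lemma seq_equiv_stutter s x t :
  is_loop (s ++ x :: t) -> is_loop (s ++ x :: x :: t) ->
  seq_equiv (s ++ x :: t) (s ++ x :: x :: t).
Proof.
move=> l1 l2; apply: seq_equiv_trans (seq_equiv_rcons l1) _.
apply: seq_equiv_near => //; first exact: is_loop_rcons.
rewrite rcons_cat; apply: all2_near_cat (all2_near_refl _) _.
rewrite rcons_cons /= near_at_refl /=.
apply: all2_near_sym; apply: all2_near_shift.
  move: l1; rewrite is_loopE => /and4P[_ + _ _].
  by rewrite sorted_cat_cons => /andP[_].
move: l1; rewrite is_loopE => /and4P[_ _ _].
by rewrite last_cat /= => /eqP ->.
Qed.

Lemma loop_cat_equiv (s s' t t' : loop) :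
  loop_equiv s s' -> loop_equiv t t' ->
  loop_equiv (loop_cat s t) (loop_cat s' t').
Proof.
move=> ss' tt'; apply/seq_equivP/(@seq_equiv_trans (s' ++ t)) => /=.
- apply: (loop_equiv_ind (F := fun u => u ++ t)) ss' => u v uv.
    have lut := loop_cat_subproof u t; have lvt := loop_cat_subproof v t.
    apply: seq_equiv_trans (seq_equiv_rcons lut) _.
    apply: seq_equiv_near => //; first exact: is_loop_rcons.
    rewrite uv cat_rcons rcons_cat; apply: all2_near_cat (all2_near_refl _) _.
    exact/all2_near_sym/all2_near_shift_loop/loopP.
  apply: seq_equiv_near (loop_cat_subproof u t) (loop_cat_subproof v t) _.
  exact: all2_near_cat (all2_near_refl _).
- apply: (loop_equiv_ind (F := fun u => s' ++ u)) tt' => u v uv.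
    rewrite uv -rcons_cat; apply: seq_equiv_rcons.
    exact: loop_cat_subproof.
  apply: seq_equiv_near (loop_cat_subproof s' u) (loop_cat_subproof s' v) _.
  exact: all2_near_cat (all2_near_refl _) uv.
Qed.

Lemma loop_rev_equiv (s t : loop) :
  loop_equiv s t -> loop_equiv (loop_rev s) (loop_rev t).
Proof.
move=> st; apply/seq_equivP => /=.
apply: (loop_equiv_ind (F := fun u => rev u)) st => u v uv.
  have lu := loop_rev_subproof u; have lv := loop_rev_subproof v.
  apply: seq_equiv_trans (seq_equiv_rcons lu) _.
  apply: seq_equiv_near => //; first exact: is_loop_rcons.
  by rewrite uv rev_rcons; apply/all2_near_sym/all2_near_shift_loop.
apply: seq_equiv_near (loop_rev_subproof u) (loop_rev_subproof v) _.
by elim: (u : seq X) (v : seq X) uv => [|x a IHa] [|y b] //= /andP[xy ab];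
  rewrite !rev_cons -!cats1; apply: all2_near_cat; rewrite ?IHa//= xy.
Qed.

Lemma loop_catA (s t u : loop) :
  loop_cat s (loop_cat t u) = loop_cat (loop_cat s t) u.
Proof. by apply: val_inj; rewrite /= catA. Qed.

Lemma loop_cats1 (s : loop) : loop_equiv (loop_cat s loop_one) s.
Proof.
apply/seq_equivP/seq_equiv_sym => /=.
apply: seq_equiv_trans (seq_equiv_rcons (loopP s)) _.
apply: seq_equiv_trans (seq_equiv_rcons (is_loop_rcons (loopP s))) _.
rewrite -!cats1 -catA; apply: seq_equiv_refl.
exact: (loop_cat_subproof s loop_one).
Qed.

Lemma seq_equiv_cons s : is_loop s -> seq_equiv s (p :: s).
Proof.
move=> ls; have lps : is_loop (p :: s).
  move: ls; rewrite !is_loopE; case: s => // x s /and4P[_ /= -> /eqP -> ->].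
  by rewrite eqxx near_at_refl.
apply: seq_equiv_trans (seq_equiv_rcons ls) _.
apply: seq_equiv_near => //; first exact: is_loop_rcons.
exact/all2_near_sym/all2_near_shift_loop.
Qed.

Lemma loop_cat1s (s : loop) : loop_equiv (loop_cat loop_one s) s.
Proof.
apply/seq_equivP/seq_equiv_sym => /=.
have sps := seq_equiv_cons (loopP s).
apply: seq_equiv_trans (sps) _; apply: seq_equiv_cons.
by case: sps => [_ [v [_ <- _]]]; apply: loopP.
Qed.

Lemma seq_equiv_inv s : path near_at p s ->
  seq_equiv ((p :: s) ++ rev (p :: s)) [:: p; p].
Proof.
have revE t : rev (p :: t) = last p t :: rev (belast p t).
  by rewrite lastI rev_rcons.
have loop_inv t m : path near_at p t -> path near_at (last p t) m ->
    near_at (last (last p t) m) (last p t) -> is_loop ((p :: t) ++ m ++ rev (p :: t)).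
  move=> pt pm mp; rewrite is_loopE; apply/and4P; split=> //.
  - by rewrite !size_cat size_rev /= addSn addnA addnS.
  - rewrite /= !cat_path pt pm revE /= mp rev_path.
    by rewrite (@eq_path _ _ near_at)// => x y; rewrite near_at_sym.
  - by rewrite !last_cat rev_cons last_rcons.
elim/last_ind: s => [_|s x IHs]; first exact: seq_equiv_refl loop_one_subproof.
rewrite rcons_path => /andP[ps sx].
apply: seq_equiv_trans (IHs ps).
rewrite -rcons_cons rev_rcons cat_rcons.
set y := last p s in sx *.
have l0 : is_loop ((p :: s) ++ [::] ++ rev (p :: s)) by apply: loop_inv.
have l1 : is_loop ((p :: s) ++ [:: y] ++ rev (p :: s)).
  by apply: loop_inv => //=; rewrite near_at_refl.
have l2 : is_loop ((p :: s) ++ [:: y; y] ++ rev (p :: s)).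
  by apply: loop_inv => //=; rewrite !near_at_refl.
have l3 : is_loop ((p :: s) ++ [:: x; x] ++ rev (p :: s)).
  by apply: loop_inv; rewrite //= ?sx ?near_at_refl// near_at_sym.
apply: (@seq_equiv_trans ((p :: s) ++ [:: y; y] ++ rev (p :: s))).
  apply: seq_equiv_near => //; apply: all2_near_cat (all2_near_refl _) _.
  by rewrite /= near_at_sym sx /= all2_near_refl.
apply: seq_equiv_sym.
apply: (@seq_equiv_trans ((p :: s) ++ [:: y] ++ rev (p :: s))).
  by move: l0 l1; rewrite revE; apply: seq_equiv_stutter.
by move: l1 l2; apply: seq_equiv_stutter.
Qed.

Lemma loop_cats_rev (s : loop) : loop_equiv (loop_cat s (loop_rev s)) loop_one.
Proof.
apply/seq_equivP => /=; case: s => s /=.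
rewrite is_loopE; case: s => // x s /and4P[_ /= xs /eqP xp _].
by rewrite {}xp in xs *; apply: seq_equiv_inv.
Qed.

Lemma loop_revK : involutive loop_rev.
Proof. by move=> s; apply: val_inj; rewrite /= revK. Qed.

Lemma loop_cat_revs (s : loop) : loop_equiv (loop_cat (loop_rev s) s) loop_one.
Proof. by have := loop_cats_rev (loop_rev s); rewrite loop_revK. Qed.

(* The group A_{1,r}(X,p) *)
Definition A1 := {eq_quot loop_equiv}.

HB.instance Definition _ : EqQuotient loop loop_equiv A1 := EqQuotient.on A1.
HB.instance Definition _ := Choice.on A1.

Definition A1_one : A1 := lift_cst A1 loop_one.
Definition A1_mul := lift_op2 A1 loop_cat.
Definition A1_inv := lift_op1 A1 loop_rev.

Canonical pi_A1_one_morph := PiConst A1_one.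

Lemma A1_eqP (s t : loop) : reflect (s = t %[mod A1]) (loop_equiv s t).
Proof. exact: eqmodP. Qed.

Lemma pi_A1_mul : {morph \pi : s t / loop_cat s t >-> A1_mul s t}.
Proof.
move=> s t; unlock A1_mul; apply/A1_eqP/loop_cat_equiv; apply/A1_eqP;
  by rewrite reprK.
Qed.
Canonical pi_A1_mul_morph := PiMorph2 pi_A1_mul.

Lemma pi_A1_inv : {morph \pi : s / loop_rev s >-> A1_inv s}.
Proof.
by move=> s; unlock A1_inv; apply/A1_eqP/loop_rev_equiv/A1_eqP; rewrite reprK.
Qed.
Canonical pi_A1_inv_morph := PiMorph1 pi_A1_inv.

Lemma A1_mulA : associative A1_mul.
Proof.
by move=> x y z; rewrite -[x]reprK -[y]reprK -[z]reprK !piE loop_catA.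
Qed.

Lemma A1_mul1 : left_id A1_one A1_mul.
Proof.
move=> x; rewrite -[x]reprK !piE; apply/A1_eqP; exact: loop_cat1s.
Qed.

Lemma A1_1mul : right_id A1_one A1_mul.
Proof.
move=> x; rewrite -[x]reprK !piE; apply/A1_eqP; exact: loop_cats1.
Qed.

Lemma A1_mulV : left_inverse A1_one A1_inv A1_mul.
Proof.
move=> x; rewrite -[x]reprK !piE; apply/A1_eqP; exact: loop_cat_revs.
Qed.

Lemma A1_Vmul : right_inverse A1_one A1_inv A1_mul.
Proof.
move=> x; rewrite -[x]reprK !piE; apply/A1_eqP; exact: loop_cats_rev.
Qed.

HB.instance Definition _ :=
  isGroup.Build A1 A1_mulA A1_mul1 A1_1mul A1_mulV A1_Vmul.

End FundamentalGroup.

(* Main.v *)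
(* As for the classical Hurewicz theorem in degree 1. A loop is sent to the sum
   of its edges. Modulo boundaries this only depends on the loop class: two
   consecutive rows of a grid bound a strip of singular 2-cubes whose boundaries
   telescope. The target being abelian, this factors through the abelianization.
   Conversely, choose an r-path from p to every point; an edge xy is sent to the
   class of the loop which goes from p to x, crosses the edge, and comes back
   from y to p along the chosen paths. This kills degenerate edges and boundaries
   of 2-cubes, and on cycles the contributions of the chosen paths cancel, so the
   two maps are inverse to each other. *)

From HB Require Import structures.
From mathcomp Require Import freeg generic_quotient.
Require Import Defs.
From mathcomp Require Import all_boot all_order all_algebra.
From mathcomp Require Import boolp reals interval_inference metric_structure.

Set Implicit Arguments.
Unset Strict Implicit.
Unset Printing Implicit Defensive.

Import Order.TTheory GRing.Theory Num.Theory.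

Local Open Scope ring_scope.
Local Open Scope quotient_scope.

(** * Singular cubes of dimension at most 2 given by their vertices *)

Section Cubes.
Variables (R : realType) (X : metricType R) (r : {posnum R}).
Local Notation near := (near_at r).
Local Notation cube n := (cube X r n).
Local Notation Lgrp n := (Lgrp X r n).

Lemma hammingE n (a b : vertex n) :
  hamming a b = (\sum_(i < n) (a i != b i))%N.
Proof.
rewrite /hamming -sum1_card big_mkcond; apply: eq_bigr => i _.
by rewrite inE; case: ifP.
Qed.

Lemma const_lipschitz n (x : X) :
  lipschitz r [ffun _ : vertex n => x].
Proof.
apply/forallP => a; apply/forallP => b.
by rewrite !ffunE mdistxx mulr_ge0.
Qed.

(** When [f] is not r-Lipschitz the result is the constant cube at [x]. This makes [edge] and
    [square] total, and nearness hypotheses appear only where values are computed. *)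
Definition mkcube n (x : X) (f : vertex n -> X) : cube n :=
  insubd (Cube (const_lipschitz n x)) (finfun f).

Lemma mkcube_const n (x : X) :
  mkcube x (fun=> x) = [ffun _ : vertex n => x] :> {ffun _ -> _}.
Proof. by rewrite [LHS]val_insubd if_same. Qed.

Definition edge (x y : X) : cube 1 :=
  mkcube x (fun a : vertex 1 => if a ord0 then y else x).

Definition square (a b c d : X) : cube 2 :=
  mkcube a (fun v : vertex 2 =>
    if v ord0 then if v ord_max then d else c else if v ord_max then b else a).

Definition vertex1 (c : bool) : vertex 1 := [ffun=> c].

Definition vertex2 (c d : bool) : vertex 2 :=
  [ffun i => if i == ord0 then c else d].

Lemma edge_val x y : near x y ->
  edge x y = [ffun a : vertex 1 => if a ord0 then y else x] :> {ffun _ -> _}.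
Proof.
move=> xy; rewrite [LHS]val_insubd ifT//.
apply/forallP => a; apply/forallP => b; rewrite !ffunE hammingE big_ord1.
by case: (a ord0); case: (b ord0); rewrite ?mdistxx ?mulr0 ?mulr1// metric_sym.
Qed.

Lemma square_val a b c d : near a b -> near b d -> near a c -> near c d ->
  square a b c d = [ffun v : vertex 2 =>
    if v ord0 then if v ord_max then d else c else if v ord_max then b else a]
    :> {ffun _ -> _}.
Proof.
move=> ab bd ac cd; rewrite [LHS]val_insubd ifT//.
(* Opposite corners have Hamming distance 2 and are compared through a common neighbour. The
   constant is kept as [1 + 1], the form in which the Hamming sum appears below. *)
have tri (x y z : X) : near x y -> near y z -> mdist x z <= r%:num * (1 + 1)%:R.
  move=> xy yz; rewrite mulr_natr mulr2n.
  exact: le_trans (metric_triangle _ _ _) (lerD xy yz).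
have ns (x y : X) : near x y -> near y x by rewrite near_at_sym.
apply/forallP => v; apply/forallP => w; rewrite !ffunE hammingE.
rewrite big_ord_recl big_ord1 (_ : lift ord0 ord0 = ord_max); last exact: val_inj.
case: (v ord0); case: (v ord_max); case: (w ord0); case: (w ord_max) => /=;
  rewrite ?mdistxx ?addn0 ?add0n ?mulr0 ?mulr1 ?mulr_ge0//; try exact: ns.
- by apply: (tri _ b); apply: ns.
- by apply: (tri _ a) => //; apply: ns.
- by apply: (tri _ a) => //; apply: ns.
- exact: (tri _ b).
Qed.

Lemma cube1_eq (s t : cube 1) :
  s (vertex1 false) = t (vertex1 false) ->
  s (vertex1 true) = t (vertex1 true) -> s = t.
Proof.
move=> st0 st1; apply/val_inj/ffunP => v.
suff -> : v = vertex1 (v ord0) by case: (v ord0).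
by apply/ffunP => i; rewrite ffunE ord1.
Qed.

Lemma cube_near n (s : cube n) (a b : vertex n) :
  (hamming a b <= 1)%N -> near (s a) (s b).
Proof.
move=> ab; have /forallP/(_ a)/forallP/(_ b)/le_trans := cubeP s; apply.
by rewrite -[leRHS]mulr1 ler_wpM2l// lern1.
Qed.

Lemma hamming_vertex1 c d : hamming (vertex1 c) (vertex1 d) = (c != d).
Proof. by rewrite hammingE big_ord1 !ffunE. Qed.

Lemma hamming_vertex2 c d c' d' :
  hamming (vertex2 c d) (vertex2 c' d') = ((c != c') + (d != d'))%N.
Proof. by rewrite hammingE big_ord_recl big_ord1 !ffunE. Qed.

Lemma cube1E (s : cube 1) : s = edge (s (vertex1 false)) (s (vertex1 true)).
Proof.
have near_s : near (s (vertex1 false)) (s (vertex1 true)).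
  by apply: cube_near; rewrite hamming_vertex1.
by apply: cube1_eq; rewrite edge_val// !ffunE.
Qed.

Lemma vinsert_vertex1 (i : 'I_2) c d :
  vinsert i c (vertex1 d) = if i == ord0 then vertex2 c d else vertex2 d c.
Proof.
apply/ffunP => j; have [k ->|->] := unliftP i j; last first.
  by rewrite vinsert_same; case: ifP => i0; rewrite ffunE i0.
rewrite vinsert_lift ffunE (_ : (k : 'I_1) = ord0) ?ord1//.
by case: i k => -[|[|//]] i [[|//] k]; rewrite ffunE.
Qed.

Lemma face_square (s : cube 2) (i : 'I_2) c : face i c s =
  if i == ord0 then edge (s (vertex2 c false)) (s (vertex2 c true))
  else edge (s (vertex2 false c)) (s (vertex2 true c)).
Proof.
rewrite [LHS]cube1E !ffunE !vinsert_vertex1.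
by case: ifP.
Qed.

Lemma cube2_boundary (s : cube 2) :
  let e v w := gen (edge (s v) (s w)) in
  cube_boundary s =
    (e (vertex2 true false) (vertex2 true true) -
     e (vertex2 false false) (vertex2 false true)) +
    (e (vertex2 false false) (vertex2 true false) -
     e (vertex2 false true) (vertex2 true true)).
Proof.
move=> /=; rewrite /cube_boundary big_ord_recl big_ord1 !face_square /=.
by rewrite expr1 scaleN1r opprB sqrrN expr1n scale1r.
Qed.

Lemma cube1_boundary x y : near x y ->
  cube_boundary (edge x y) = gen (mkcube y (fun=> y)) - gen (mkcube x (fun=> x)).
Proof.
move=> xy; rewrite /cube_boundary big_ord1 expr1 scaleN1r opprB.
by congr (gen _ - gen _); apply/val_inj/ffunP => v;
  rewrite /= mkcube_const ffunE edge_val// !ffunE unlift_none.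
Qed.

Lemma edge_refl_degenerate x : degenerate (edge x x).
Proof.
exists ord0; apply/val_inj/ffunP => v; rewrite !ffunE edge_val ?near_at_refl//.
by rewrite !ffunE !if_same.
Qed.

Lemma degenerate1 (s : cube 1) : degenerate s ->
  s (vertex1 false) = s (vertex1 true).
Proof.
move=> [i /(congr1 (fun t : cube 0 => t [ffun=> false]))]; rewrite !ffunE.
have vE c : vinsert i c [ffun=> false] = vertex1 c.
  by apply/ffunP => j; rewrite (ord1 j) -(ord1 i) vinsert_same ffunE.
by rewrite !vE.
Qed.

End Cubes.

(** * 1-chains modulo degenerate cubes and boundaries *)

Section ChainsModBoundaries.
Variables (R : realType) (X : metricType R) (r : {posnum R}).
Local Notation near := (near_at r).
Local Notation cube n := (cube X r n).
Local Notation Lgrp n := (Lgrp X r n).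

(** A chain is a finite sum of integer multiples of cubes, and 0 together with subtraction produces
    opposites, sums and multiples. *)
Lemma Lgrp_ind n (P : Lgrp n -> Prop) :
  P 0 -> (forall s : cube n, P (gen s)) -> (forall x y, P x -> P y -> P (x - y)) ->
  forall x, P x.
Proof.
move=> P0 Pgen PB x; have PN y : P y -> P (- y).
  by move=> Py; rewrite -[- y]add0r; apply: PB.
have PD y z : P y -> P z -> P (y + z).
  by move=> Py Pz; rewrite -[z]opprK; apply/PB/PN.
have PM y k : P y -> P (y *+ k).
  by move=> Py; elim: k => [|k IHk]; rewrite ?mulr0n// mulrS; apply: PD.
rewrite -[x]freeg_sumE; elim/big_ind: _ => //= s _.
rewrite -[coeff s x]intz -freegU_mulz.
case: (coeff s x) => k; rewrite ?NegzE ?mulrNz -pmulrn; [|apply: PN];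
  exact/PM/Pgen.
Qed.

Definition null_pred : {pred Lgrp 1} :=
  fun x => `[< exists c : Lgrp 2, x - Lboundary c \in @Dgrp _ X r 1 >].

Lemma null_closed : zmod_closed null_pred.
Proof.
split=> [|x y /asboolP[c cx] /asboolP[d dy]].
  by apply/asboolP; exists 0; rewrite raddf0 subr0 rpred0.
apply/asboolP; exists (c - d); rewrite raddfB/= opprD opprK addrACA.
by rewrite [- y + _]addrC -[Lboundary d - y]opprB rpredB.
Qed.

HB.instance Definition _ := GRing.isZmodClosed.Build (Lgrp 1) null_pred null_closed.

(* The 1-chains modulo degenerate cubes and boundaries; DH embeds in it as the
   classes of cycles. *)
Definition Q1 := {ideal_quot null_pred}.
HB.instance Definition _ := GRing.Zmodule.on Q1.

Definition toQ (x : Lgrp 1) : Q1 := \pi_Q1 x.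

Lemma toQ_is_zmod_morphism : zmod_morphism toQ.
Proof. by move=> x y; rewrite /toQ -[in RHS]raddfB. Qed.

HB.instance Definition _ :=
  GRing.isZmodMorphism.Build (Lgrp 1) Q1 toQ toQ_is_zmod_morphism.

Lemma toQ_eq0 x : (toQ x == 0) = (x \in null_pred).
Proof. by rewrite -[x in RHS]subr0 Quotient.idealrBE -[0 in LHS](raddf0 toQ). Qed.

Lemma toQ_degenerate x : x \in @Dgrp _ X r 1 -> toQ x = 0.
Proof.
by move=> Dx; apply/eqP; rewrite toQ_eq0; apply/asboolP; exists 0; rewrite raddf0 subr0.
Qed.

Lemma toQ_boundary (c : Lgrp 2) : toQ (Lboundary c) = 0.
Proof.
by apply/eqP; rewrite toQ_eq0; apply/asboolP; exists c; rewrite subrr rpred0.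
Qed.

Definition qedge x y : Q1 := toQ (gen (edge r x y)).

Lemma qedge_refl x : qedge x x = 0.
Proof.
apply/toQ_degenerate/asboolP/zspan_gen; exists (edge r x x) => //.
exact: edge_refl_degenerate.
Qed.

(** The difference of the two sides is, up to sign, the boundary of the 2-cube
    [square r a b c d]. *)
Lemma qedge_square a b c d : near a b -> near b d -> near a c -> near c d ->
  qedge a b + qedge b d = qedge a c + qedge c d.
Proof.
move=> ab bd ac cd; apply/esym/eqP; rewrite -subr_eq0.
have := toQ_boundary (gen (square r a b c d)).
rewrite Lboundary_gen cube2_boundary square_val// !ffunE/=.
rewrite raddfD !raddfB /= -/(qedge _ _) => <-.
by rewrite eq_sym addrACA -opprD (addrC (qedge c d)).
Qed.

Lemma qedgeC x y : near x y -> qedge y x = - qedge x y.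
Proof.
move=> xy; apply/eqP; rewrite -addr_eq0; apply/eqP.
(* In the square with corners y, x, y, y one way around runs along the edge and back, the other
   consists of two constant edges. *)
by rewrite (@qedge_square y x y y) ?near_at_refl// ?qedge_refl ?addr0// near_at_sym.
Qed.

Fixpoint walk (x : X) (s : seq X) : Lgrp 1 :=
  if s is y :: s' then gen (edge r x y) + walk y s' else 0.

Local Notation qwalk x s := (toQ (walk x s)).

Lemma qwalk_cons x y s : qwalk x (y :: s) = qedge x y + qwalk y s.
Proof. exact: raddfD. Qed.

Lemma walk_cat x s t : walk x (s ++ t) = walk x s + walk (last x s) t.
Proof. by elim: s x => [|y s IHs] x /=; rewrite ?add0r// IHs addrA. Qed.

Lemma walk_rcons x s y : walk x (rcons s y) = walk x s + gen (edge r (last x s) y).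
Proof. by rewrite -cats1 walk_cat /= addr0. Qed.

Lemma qwalk_rev x s : path near x s ->
  qwalk (last x s) (rev (belast x s)) = - qwalk x s.
Proof.
elim: s x => [|y s IHs] x /=; first by rewrite raddf0 oppr0.
move=> /andP[xy ys]; rewrite rev_cons walk_rcons !raddfD /= IHs//.
rewrite -/(qedge _ _) (_ : last _ (rev (belast y s)) = y); last first.
  by case: s {IHs ys} => //= z s; rewrite rev_cons last_rcons.
by rewrite qedgeC// addrC.
Qed.

(** The two rows bound a strip of squares, and neighbouring squares cancel along their common
    vertical edge. The induction handles the tails and leaves the first square, with corners x, x',
    y, y'. *)
Lemma qwalk_near x s y t : path near x s -> path near y t ->
  all2 near (x :: s) (y :: t) ->
  qwalk x s + qedge (last x s) (last y t) = qedge x y + qwalk y t.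
Proof.
elim: s x y t => [|x' s IHs] x y [|y' t] //=.
- by rewrite raddf0 add0r addr0.
- by move=> _ _ /andP[].
- by move=> _ _ /andP[].
move=> /andP[xx' xs] /andP[yy' yt] /and3P[xy xy' st].
rewrite !qwalk_cons -addrA IHs//= ?xy'// !addrA; congr (_ + _).
exact: qedge_square.
Qed.

(** * The chain of a loop and its factorization through the abelianization *)

Section LoopInvariance.
Variable p : X.
Local Notation loop := (loop r p).

Definition chain (s : seq X) : Lgrp 1 := walk (head p s) (behead s).

Lemma loop_consP (s : loop) : exists s', [/\ loop_val s = p :: s',
  (0 < size s')%N, path near p s' & last p s' = p].
Proof.
case: s => -[|x s] /=; rewrite is_loopE// => /and4P[/= ? ? /eqP xp /eqP ls].
by rewrite xp in ls *; exists s; split => //; rewrite -xp.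
Qed.

(** The two vertical ends of the strip in [qwalk_near] are constant edges at p, which vanish. *)
Lemma chain_near (s t : loop) : all2 near s t ->
  toQ (chain s) = toQ (chain t).
Proof.
have [s' [-> _ ps sp]] := loop_consP s; have [t' [-> _ pt tp]] := loop_consP t.
move=> /(qwalk_near ps pt); rewrite sp tp qedge_refl addr0 add0r.
by [].
Qed.

Lemma chain_rcons (s : loop) : toQ (chain (rcons s p)) = toQ (chain s).
Proof.
have [s' [-> _ ps sp]] := loop_consP s.
by rewrite /chain /= walk_rcons raddfD /= -/(qedge _ _) sp qedge_refl addr0.
Qed.

(** Concatenation repeats p at the junction; the extra edge is constant, hence 0 modulo degenerate
    cubes. *)
Lemma chain_cat (s t : loop) : toQ (chain (s ++ t)) = toQ (chain s) + toQ (chain t).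
Proof.
have [s' [-> _ ps sp]] := loop_consP s; have [t' [-> _ pt tp]] := loop_consP t.
rewrite /chain /= walk_cat sp raddfD /= raddfD /= -/(qedge _ _) qedge_refl.
by rewrite add0r.
Qed.

(** Consecutive rows are pointwise near because the columns are r-paths, so [chain_near] applies row
    by row. *)
Lemma chain_grid m n (M : 'M[X]_(m.+1, n)) :
  (forall i, is_loop r p (codom (M i))) ->
  (forall j, is_rpath r (codom (M^~ j))) ->
  forall i, toQ (chain (codom (M i))) = toQ (chain (codom (M ord0))).
Proof.
move=> rowM colM [i im]; elim: i im => [|i IHi] im.
  by congr (toQ (chain (codom (M _)))); apply: val_inj.
rewrite -(IHi (ltnW im)); apply/esym.
apply: (@chain_near (Loop (rowM _)) (Loop (rowM _))) => /=.
rewrite !codomE; elim: (enum 'I_n) => //= j e ->; rewrite andbT.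
have /andP[_ /(sortedP p)/(_ i)] := colM j.
rewrite size_codom card_ord => /(_ im).
have nthE l (lm : (l < m.+1)%N) : nth p (codom (M^~ j)) l = M (Ordinal lm) j.
  rewrite codomE (nth_map ord0) ?size_enum_ord//; congr (M _ j).
  by apply: val_inj; rewrite /= nth_enum_ord.
by rewrite (nthE _ (ltnW im)) (nthE _ im).
Qed.

Lemma chain_equiv (s t : loop) : loop_equiv s t ->
  toQ (chain s) = toQ (chain t).
Proof.
move=> /asboolP; elim=> {s t} // [s t []|s t u _ -> _ ->//].
  by move=> ->; rewrite chain_rcons.
move=> m n M -> -> rowM colM; apply/esym.
by rewrite (chain_grid rowM colM ord_max).
Qed.

(** The sum telescopes. For a loop both end points are p, which makes its chain a cycle. *)
Lemma chain_boundary x s : path near x s ->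
  Lboundary (walk x s) = gen (mkcube r (last x s) (fun=> last x s))
    - gen (mkcube r x (fun=> x)).
Proof.
elim: s x => [|y s IHs] x /=; first by rewrite raddf0 subrr.
move=> /andP[xy ys]; rewrite raddfD /= IHs// Lboundary_gen cube1_boundary//.
by rewrite addrC addrA subrK.
Qed.

Definition A1_chain (a : A1 r p) : Q1 := toQ (chain (repr a)).

Lemma A1_chain_pi (s : loop) : A1_chain (\pi_(A1 r p) s) = toQ (chain s).
Proof. by apply/chain_equiv/A1_eqP; rewrite reprK. Qed.

Lemma A1_chainM (a b : A1 r p) : A1_chain (a * b)%g = A1_chain a + A1_chain b.
Proof.
rewrite -[a]reprK -[b]reprK -[(_ * _)%g](pi_A1_mul (repr a)) !A1_chain_pi.
exact: chain_cat.
Qed.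

Lemma A1_chain1 : A1_chain 1%g = 0.
Proof. by apply: (@addrI _ (A1_chain 1%g)); rewrite -A1_chainM mulg1 addr0. Qed.

Lemma A1_chainV (a : A1 r p) : A1_chain a^-1%g = - A1_chain a.
Proof. by apply/eqP; rewrite -addr_eq0 -A1_chainM mulVg A1_chain1. Qed.

Lemma A1_chain_derived (a : A1 r p) : derived a -> A1_chain a = 0.
Proof.
elim=> [|x y|x y _ IHx _ IHy|x _ IHx]; first exact: A1_chain1.
- rewrite commgEl conjgE !A1_chainM !A1_chainV.
  by rewrite (addrC (A1_chain x)) (addKr (A1_chain y)) addNr.
- by rewrite A1_chainM IHx IHy addr0.
- by rewrite A1_chainV IHx oppr0.
Qed.

Definition ab_chain (a : abelianization (A1 r p)) : Q1 := A1_chain (repr a).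

Lemma ab_chain_pi (a : A1 r p) : ab_chain (\pi a) = A1_chain a.
Proof.
have /ab_equivP/asboolP/A1_chain_derived : repr (\pi_(abelianization (A1 r p)) a)
  = a %[mod abelianization (A1 r p)] by rewrite reprK.
by rewrite A1_chainM A1_chainV => /eqP; rewrite addrC subr_eq0 => /eqP.
Qed.

Lemma ab_chainM (a b : abelianization (A1 r p)) :
  ab_chain (a * b)%g = ab_chain a + ab_chain b.
Proof.
rewrite -[a]reprK -[b]reprK -[(_ * _)%g](pi_ab_mul (repr a)) !ab_chain_pi.
exact: A1_chainM.
Qed.

End LoopInvariance.
End ChainsModBoundaries.

(** * Classes of loops and cancellation of backtracking *)

Section LoopClasses.
Variables (R : realType) (X : metricType R) (r : {posnum R}) (p : X).
Local Notation near := (near_at r).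
Local Notation is_loop := (is_loop r p).
Local Notation seq_equiv := (seq_equiv r p).

(** A sequence that is not a loop gets the class of the trivial loop, so explicit sequences have a
    class without carrying a proof. *)
Definition loop_class (s : seq X) : A1 r p := \pi_(A1 r p) (insubd (loop_one r p) s).

Lemma loop_classE (s : loop r p) : loop_class s = \pi s.
Proof. by rewrite /loop_class valKd. Qed.

Lemma loop_class_eq s t : seq_equiv s t -> loop_class s = loop_class t.
Proof. by move=> [u [v [<- <- uv]]]; rewrite !loop_classE; apply/A1_eqP. Qed.

Lemma loop_class_cat s t : is_loop s -> is_loop t ->
  loop_class (s ++ t) = (loop_class s * loop_class t)%g.
Proof.
move=> ls lt.
rewrite -[s]/(loop_val (Loop ls)) -[t]/(loop_val (Loop lt)) !loop_classE.
by rewrite -[RHS](pi_A1_mul (Loop ls)) -loop_classE.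
Qed.

(** A subpath is exchanged for another one with the same ends. The bound on [size v] keeps the
    length at least 2 even if [s1] and [s2] are empty. *)
Lemma is_loop_subst s1 s2 x u v :
  is_loop (s1 ++ (x :: u) ++ s2) -> path near x v -> last x v = last x u ->
  (0 < size v)%N -> is_loop (s1 ++ (x :: v) ++ s2).
Proof.
rewrite !is_loopE => /and4P[_ ss hs ls] xv vu v0; apply/and4P; split.
- by rewrite !size_cat/= addSn addnS ltnS ltn_addl// ltn_addr.
- move: ss; rewrite /= !sorted_cat_cons !cat_path vu xv.
  by move=> /and3P[-> _ ->].
- by case: s1 hs {ss ls}.
- by move: ls; rewrite !last_cat /= vu.
Qed.

(** The excursion is shortened from its tip: the two copies of the farthest point z move to its
    predecessor y, and then the repetitions of y are removed. *)
Lemma seq_equiv_cancel s t x w : path near x w -> is_loop (s ++ [:: x; x] ++ t) ->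
  seq_equiv (s ++ (x :: w) ++ rev (x :: w) ++ t) (s ++ [:: x; x] ++ t).
Proof.
move=> + lst; elim/last_ind: w => [_|w z IHw]; first exact: seq_equiv_refl.
rewrite rcons_path => /andP[xw]; set y := last x w => yz.
have revE : rev (x :: w) = y :: rev (belast x w) by rewrite lastI rev_rcons.
(* The [m] inserted between the way out and the way back will be empty, y, yy and zz in turn. *)
have lm m : path near y m -> near (last y m) y ->
    is_loop ((s ++ x :: w) ++ m ++ rev (x :: w) ++ t).
  move=> ym my.
  have -> : (s ++ x :: w) ++ m ++ rev (x :: w) ++ t =
      s ++ (x :: w ++ m ++ rev (x :: w)) ++ t by rewrite cat_cons -!catA.
  apply: (is_loop_subst lst).
  - rewrite !cat_path xw -/y ym revE /= my rev_path.
    by rewrite (@eq_path _ _ near)// => ? ?; rewrite near_at_sym.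
  - by rewrite !last_cat rev_cons last_rcons.
  - by rewrite !size_cat size_rev addnA addnS.
have [l0 l1 l2 l3] : [/\ is_loop ((s ++ x :: w) ++ [::] ++ rev (x :: w) ++ t),
    is_loop ((s ++ x :: w) ++ [:: y] ++ rev (x :: w) ++ t),
    is_loop ((s ++ x :: w) ++ [:: y; y] ++ rev (x :: w) ++ t) &
    is_loop ((s ++ x :: w) ++ [:: z; z] ++ rev (x :: w) ++ t)].
  by split; apply: lm; rewrite //= ?yz ?near_at_refl// near_at_sym.
apply: seq_equiv_trans (IHw xw).
rewrite -rcons_cons rev_rcons cat_rcons !catA -![(_ ++ rev _) ++ t]catA -!catA.
rewrite -cat_cons catA.
apply: (@seq_equiv_trans _ _ _ _ ((s ++ x :: w) ++ [:: y; y] ++ rev (x :: w) ++ t)).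
  apply: seq_equiv_near => //; apply: all2_near_cat; first exact: all2_near_refl.
  by rewrite /= near_at_sym yz /= all2_near_refl.
apply: seq_equiv_sym.
apply: (@seq_equiv_trans _ _ _ _ ((s ++ x :: w) ++ [:: y] ++ rev (x :: w) ++ t)).
  by rewrite [s ++ _]catA; move: l0 l1; rewrite revE; apply: seq_equiv_stutter.
by move: l1 l2; rewrite revE; apply: seq_equiv_stutter.
Qed.

End LoopClasses.

(** * The abelianization written additively *)

Section AbelianizationZmodule.
Variable G : groupType.

Lemma abelianization_mulC : commutative (@ab_mul G).
Proof.
move=> x y; rewrite -[x]reprK -[y]reprK !piE; apply/ab_equivP/asboolP.
move: (repr x) (repr y) => a b.
have -> : ((a * b)^-1 * (b * a) = [~ b, a])%g by rewrite invgM commgEl conjgE !mulgA.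
exact: derivedR.
Qed.

(** A copy of the type that carries the additive structure, so that it can be the target of
    homomorphisms out of the free abelian group of chains. *)
Definition additive_ab : Type := abelianization G.
HB.instance Definition _ := Choice.on additive_ab.
HB.instance Definition _ := GRing.isZmodule.Build additive_ab
  (@ab_mulA G) abelianization_mulC (@ab_mul1 G) (@ab_mulV G).

Definition to_ab (x : G) : additive_ab := \pi_(abelianization G) x.

Lemma to_abM x y : to_ab (x * y)%g = to_ab x + to_ab y.
Proof. exact: pi_ab_mul. Qed.

Lemma to_ab1 : to_ab 1%g = 0.
Proof. by apply: (@addrI _ (to_ab 1%g)); rewrite -to_abM mulg1 addr0. Qed.

End AbelianizationZmodule.

(** * From 1-chains to classes of loops along chosen paths *)

Section EdgeLoops.
Variables (R : realType) (X : metricType R) (r : {posnum R}) (p : X).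
Local Notation near := (near_at r).
Local Notation is_loop := (is_loop r p).
Local Notation cls := (loop_class r p).
Local Notation ab := (to_ab (G := A1 r p)).

(* [p :: g x] is a chosen r-path from p to x, the constant one when x = p. *)
Variable g : X -> seq X.
Variables (g_path : forall x, path near p (g x))
          (g_last : forall x, last p (g x) = x) (g_base : g p = [::]).

(** The point x at the end of [p :: g x] serves as the start of the path [x :: s], whereas the end
    point [last x s] occurs twice, as the way back starts with it. *)
Definition tethered (x : X) (s : seq X) : seq X :=
  (p :: g x) ++ s ++ rev (p :: g (last x s)).

Lemma rev_tether x : rev (p :: g x) = x :: rev (belast p (g x)).
Proof. by rewrite lastI g_last rev_rcons. Qed.

Lemma tethered_loop x s : path near x s -> is_loop (tethered x s).
Proof.
move=> xs; rewrite /tethered rev_tether is_loopE; apply/and4P; split => //.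
- by rewrite size_cat/= size_cat/= addSn !addnS.
- rewrite /= !cat_path/= g_path g_last xs near_at_refl /=.
  rewrite -[X in path _ X](g_last (last x s)) rev_path.
  by rewrite (@eq_path _ _ near)// => ? ?; rewrite near_at_sym.
- by rewrite !last_cat -rev_tether rev_cons last_rcons.
Qed.

Lemma tethered_stutter x s t : path near x (s ++ t) ->
  cls (tethered x (s ++ t)) = cls (tethered x (s ++ last x s :: t)).
Proof.
move=> st; have lst := tethered_loop st.
have /tethered_loop : path near x (s ++ last x s :: t).
  by move: st; rewrite !cat_path /= near_at_refl.
move: lst; rewrite /tethered !last_cat /= -!catA !cat_cons.
(* The point to be repeated is the last of [s], or of [p :: g x] if [s] is empty; [belast] isolates
   it in both cases. *)
set T := t ++ _; have split_s u : p :: g x ++ s ++ u =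
    belast p (g x ++ s) ++ last x s :: u.
  rewrite (_ : last x s = last p (g x ++ s)); last by rewrite last_cat g_last.
  by rewrite -cat_rcons -lastI cat_cons catA.
rewrite !split_s => l0 l1; exact/loop_class_eq/seq_equiv_stutter.
Qed.

(** The product of the two loops returns from y to p and goes back to y along the same chosen path;
    this excursion from y is cancelled by [seq_equiv_cancel]. *)
Lemma tethered_cat x s t : path near x s -> path near (last x s) t ->
  cls (tethered x (s ++ t)) = (cls (tethered x s) * cls (tethered (last x s) t))%g.
Proof.
set y := last x s => xs yt; rewrite -loop_class_cat; try exact: tethered_loop.
have st : path near x (s ++ y :: t) by rewrite cat_path xs /= near_at_refl.
have syyt : path near x (s ++ [:: y, y & t]).
  by rewrite cat_path xs /= !near_at_refl.
(* The cancellation leaves two more copies of y after the one that ends [(p :: g x) ++ s], hence two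
   repetitions are inserted here. *)
rewrite tethered_stutter ?cat_path ?xs// (tethered_stutter st).
apply/loop_class_eq/seq_equiv_sym.
have := @seq_equiv_cancel _ _ r p ((p :: g x) ++ s)
  (t ++ rev (p :: g (last y t))) y (rev (belast p (g y))).
rewrite -rev_tether revK /tethered last_cat /= -!catA /=; apply.
  rewrite -[X in path _ X](g_last y) rev_path.
  by rewrite (@eq_path _ _ near)// => ? ?; rewrite near_at_sym.
by have := tethered_loop syyt; rewrite /tethered last_cat /= -!catA.
Qed.

Lemma tethered_nil x : cls (tethered x [::]) = 1%g.
Proof.
rewrite (loop_class_eq (seq_equiv_inv (g_path x))).
by rewrite -[[:: p; p]]/(loop_val (loop_one r p)) loop_classE -[1%g]/(A1_one r p) !piE.
Qed.

(** The wrapper [zmodule] provides the module structure over the integers that [fglift] expects. *)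
Definition edge_value (s : cube X r 1) : zmodule (additive_ab (A1 r p)) :=
  ab (cls (tethered (s (vertex1 false)) [:: s (vertex1 true)])).

Definition Lgrp_ab (x : Lgrp X r 1) : additive_ab (A1 r p) :=
  fglift edge_value x.

Lemma Lgrp_ab_is_zmod_morphism : zmod_morphism Lgrp_ab.
Proof. exact: (lift_is_additive edge_value). Qed.

HB.instance Definition _ := GRing.isZmodMorphism.Build (Lgrp X r 1)
  (additive_ab (A1 r p)) Lgrp_ab Lgrp_ab_is_zmod_morphism.

Lemma Lgrp_ab_gen s : Lgrp_ab (gen s) =
  ab (cls (tethered (s (vertex1 false)) [:: s (vertex1 true)])).
Proof. by rewrite /Lgrp_ab liftU scale1r. Qed.

Lemma Lgrp_ab_edge x y : near x y ->
  Lgrp_ab (gen (edge r x y)) = ab (cls (tethered x [:: y])).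
Proof. by move=> xy; rewrite Lgrp_ab_gen edge_val// !ffunE. Qed.

Lemma Lgrp_ab_walk x s : path near x s ->
  Lgrp_ab (walk r x s) = ab (cls (tethered x s)).
Proof.
elim: s x => [|y s IHs] x; first by rewrite raddf0 tethered_nil to_ab1.
move=> /= /andP[xy ys]; rewrite raddfD /= Lgrp_ab_edge// IHs//.
by rewrite -to_abM -(@tethered_cat x [:: y]) //= xy.
Qed.

Lemma Lgrp_ab_edge_refl x : Lgrp_ab (gen (edge r x x)) = 0.
Proof.
rewrite Lgrp_ab_edge ?near_at_refl// -to_ab1 -(tethered_nil x).
by rewrite -(@tethered_stutter x [::] [::]).
Qed.

Lemma Lgrp_ab_square a b c d : near a b -> near b d -> near a c -> near c d ->
  Lgrp_ab (walk r a [:: b; d]) = Lgrp_ab (walk r a [:: c; d]).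
Proof.
move=> ab bd ac cd.
(* b and c may be 2r apart, so abd is not pointwise near acd, but abdd is
   pointwise near aacd. *)
have -> : Lgrp_ab (walk r a [:: b; d]) = Lgrp_ab (walk r a [:: b; d; d]).
  by rewrite -[[:: b; d; d]]/([:: b; d] ++ [:: d]) walk_cat [RHS]raddfD /= !addr0
    Lgrp_ab_edge_refl addr0.
have -> : Lgrp_ab (walk r a [:: c; d]) = Lgrp_ab (walk r a [:: a; c; d]).
  by rewrite [RHS]raddfD /= Lgrp_ab_edge_refl add0r.
have pb : path near a [:: b; d; d] by rewrite /= ab bd near_at_refl.
have pc : path near a [:: a; c; d] by rewrite /= ac cd near_at_refl.
rewrite !Lgrp_ab_walk//; congr (to_ab _); apply/loop_class_eq/seq_equiv_near.
- exact: tethered_loop.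
- exact: tethered_loop.
apply: all2_near_cat; first exact: all2_near_refl.
apply: all2_near_cat; last exact: all2_near_refl.
by rewrite /= near_at_refl !andbT near_at_sym ab near_at_sym cd.
Qed.

Lemma Lgrp_ab_boundary (c : Lgrp X r 2) : Lgrp_ab (Lboundary c) = 0.
Proof.
elim/Lgrp_ind: c => [|s|x y x0 y0]; first by rewrite !raddf0.
  have ns c d c' d' : ((c != c') + (d != d') <= 1)%N ->
      near (s (vertex2 c d)) (s (vertex2 c' d')).
    by move=> cd; apply: cube_near; rewrite hamming_vertex2.
  (* The four edges are regrouped as the difference of the two paths from corner 00 to corner 11. *)
  rewrite Lboundary_gen cube2_boundary addrACA -opprD raddfB.
  apply/eqP; rewrite subr_eq0; apply/eqP.
  have := @Lgrp_ab_square (s (vertex2 false false)) (s (vertex2 true false))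
    (s (vertex2 false true)) (s (vertex2 true true)).
  rewrite /= !addr0 addrC => ->//; exact: ns.
by rewrite !raddfB /= x0 y0 subrr.
Qed.

Lemma Lgrp_ab_degenerate x : x \in @Dgrp _ X r 1 -> Lgrp_ab x = 0.
Proof.
move=> /asboolP; elim=> [|_ [s /degenerate1 s01 <-]|y z _ y0 _ z0].
- by rewrite raddf0.
- by rewrite [s]cube1E s01 Lgrp_ab_edge_refl.
- by rewrite raddfB /= y0 z0 subrr.
Qed.

(** As [g p] is empty, tethering a loop based at p only appends p, which does not change its
    class. *)
Lemma Lgrp_ab_chain (s : loop r p) : Lgrp_ab (chain r p s) = ab (\pi s).
Proof.
have [s' [sE _ ps sp]] := loop_consP s.
rewrite -loop_classE sE /chain /= Lgrp_ab_walk//.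
rewrite /tethered sp g_base rev_cons /= cats1 -rcons_cons -sE.
by congr (ab _); apply/esym/loop_class_eq/seq_equiv_rcons/loopP.
Qed.

Definition Q1_ab (q : Q1 X r) : additive_ab (A1 r p) := Lgrp_ab (repr q).

Lemma Q1_ab_toQ x : Q1_ab (toQ x) = Lgrp_ab x.
Proof.
apply/eqP; rewrite -subr_eq0 -raddfB /=.
have : repr (toQ x) - x \in @null_pred _ X r.
  by rewrite -toQ_eq0 raddfB subr_eq0; apply/eqP/(reprK (toQ x)).
move=> /asboolP[c cx]; rewrite -[_ - x](subrK (Lboundary c)) raddfD /=.
by rewrite Lgrp_ab_degenerate// Lgrp_ab_boundary addr0.
Qed.

Lemma Q1_abD : {morph Q1_ab : x y / x + y}.
Proof.
move=> x y; rewrite -[x]reprK -[y]reprK -![\pi_(Q1 _ _) _]/(toQ _) -raddfD.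
by rewrite !Q1_ab_toQ raddfD.
Qed.

(** The doubled end point gives a constant edge, and the way back counts negatively by
    [qwalk_rev]. *)
Lemma qwalk_tethered x s : path near x s ->
  toQ (chain r p (tethered x s)) =
  toQ (walk r p (g x)) + toQ (walk r x s) - toQ (walk r p (g (last x s))).
Proof.
move=> xs; rewrite /chain /= !walk_cat g_last rev_tether /=.
set y := last x s.
rewrite !raddfD /= -addrA -/(qedge _ _ _) qedge_refl add0r; congr (_ + (_ + _)).
by rewrite -qwalk_rev// g_last.
Qed.

(* Applied to the boundary of a chain, [tether] measures the defect of
   [ab_chain] as a left inverse of [Lgrp_ab]. *)
Definition tether_value (s : cube X r 0) : zmodule (Q1 X r) :=
  - toQ (walk r p (g (s [ffun=> false]))).

Definition tether (x : Lgrp X r 0) : Q1 X r := fglift tether_value x.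

Lemma tether_is_zmod_morphism : zmod_morphism tether.
Proof. exact: (lift_is_additive tether_value). Qed.

HB.instance Definition _ := GRing.isZmodMorphism.Build (Lgrp X r 0) (Q1 X r)
  tether tether_is_zmod_morphism.

Lemma tether_gen x :
  tether (gen (mkcube r x (fun=> x))) = - toQ (walk r p (g x)).
Proof.
rewrite /tether liftU scale1r /tether_value.
by rewrite mkcube_const ffunE.
Qed.

(** On an edge from x to y both sides equal the edge plus the chosen path to x minus the chosen path
    to y; additivity does the rest. *)
Lemma ab_chain_Lgrp_ab (z : Lgrp X r 1) :
  ab_chain (Lgrp_ab z) = toQ z + tether (Lboundary z).
Proof.
have ab_chainD (u v : additive_ab (A1 r p)) :
  ab_chain (u + v) = ab_chain u + ab_chain v by exact: ab_chainM.
have ab_chain0 : ab_chain (0 : additive_ab (A1 r p)) = 0.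
  by apply: (@addrI _ (ab_chain (0 : additive_ab (A1 r p)))); rewrite -ab_chainD !addr0.
elim/Lgrp_ind: z => [|s|x y xE yE]; first by rewrite !raddf0 addr0.
  rewrite [s]cube1E; move: (s _) (s _) (@cube_near _ _ _ _ s (vertex1 false) (vertex1 true)).
  rewrite hamming_vertex1 => y x /(_ isT) xy.
  rewrite Lboundary_gen cube1_boundary// raddfB /= !tether_gen.
  rewrite Lgrp_ab_edge// ab_chain_pi.
  have xsy : path near x [:: y] by rewrite /= xy.
  rewrite -[tethered _ _]/(loop_val (Loop (tethered_loop xsy))) loop_classE.
  rewrite A1_chain_pi /= qwalk_tethered//= addr0 opprK.
  by rewrite -addrA addrC -addrA.
have -> : Lgrp_ab (x - y) = Lgrp_ab x - Lgrp_ab y by exact: raddfB.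
apply: (@addIr _ (ab_chain (Lgrp_ab y))).
by rewrite -ab_chainD subrK xE yE !raddfB /= addrACA !subrK.
Qed.

End EdgeLoops.

(** * Embedding of the first homology into chains modulo boundaries *)

Section HomologyClasses.
Variables (R : realType) (X : metricType R) (r : {posnum R}).
Local Notation Lgrp n := (Lgrp X r n).
Local Notation Cgrp n := (Cgrp X r n).
Local Notation Zgrp n := (Zgrp X r n).
Local Notation DH n := (DH X r n).

Definition CtoQ (c : Cgrp 1) : Q1 X r := toQ (repr c).

Lemma CtoQ_pi (x : Lgrp 1) : CtoQ (\pi_(Cgrp 1) x) = toQ x.
Proof.
apply/eqP; rewrite -subr_eq0 -raddfB /=; apply/eqP/toQ_degenerate/Dgrp_eqP.
by rewrite reprK.
Qed.

Lemma CtoQD : {morph CtoQ : c d / c + d}.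
Proof.
by move=> c d; rewrite -[c]reprK -[d]reprK -raddfD !CtoQ_pi raddfD.
Qed.

Lemma CtoQ_eq0 c : CtoQ c = 0 -> exists d : Cgrp 2, boundary d = c.
Proof.
move=> /eqP; rewrite toQ_eq0 => /asboolP[d /Dgrp_eqP cd].
by exists (\pi_(Cgrp 2) d); rewrite boundary_pi -[c]reprK.
Qed.

Lemma CtoQ_boundary (d : Cgrp 2) : CtoQ (boundary d) = 0.
Proof. by rewrite -[d]reprK boundary_pi CtoQ_pi toQ_boundary. Qed.

Definition DHtoQ (u : DH 1) : Q1 X r := CtoQ (cycle_val (repr u)).

Lemma DHtoQ_pi (z : Zgrp 1) : DHtoQ (\pi_(DH 1) z) = CtoQ (cycle_val z).
Proof.
have : repr (\pi_(DH 1) z) - z \in @Bgrp _ X r 1.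
  by rewrite Quotient.idealrBE reprK.
move=> /asboolP[d dE]; transitivity (CtoQ (boundary d + cycle_val z)).
  by rewrite dE -[_ + _]/(cycle_val (_ - z + z)) subrK.
by rewrite CtoQD CtoQ_boundary add0r.
Qed.

Lemma DHtoQD : {morph DHtoQ : u v / u + v}.
Proof.
by move=> u v; rewrite -[u]reprK -[v]reprK -raddfD !DHtoQ_pi CtoQD.
Qed.

(** The difference of two representing cycles with the same image is killed by [CtoQ], so it is a
    boundary by [CtoQ_eq0]. *)
Lemma DHtoQ_inj : injective DHtoQ.
Proof.
move=> u v uv; rewrite -[u]reprK -[v]reprK; apply/eqP.
rewrite -Quotient.idealrBE; apply/asboolP/CtoQ_eq0.
apply: (@addIr _ (DHtoQ v)); rewrite -CtoQD add0r.
by rewrite -[_ + _]/(cycle_val (repr u - repr v + repr v)) subrK.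
Qed.

(** A 0-cube has no coordinate along which it could be degenerate. *)
Lemma Dgrp0 (x : Lgrp 0) : x \in @Dgrp _ X r 0 -> x = 0.
Proof.
by move=> /asboolP; elim=> [//|_ [s [[]]]|y z _ -> _ ->]//; rewrite subrr.
Qed.

(** A priori the boundary of a representative vanishes only modulo degenerate 0-cubes. Its exact
    vanishing removes the [tether] term in [ab_chain_Lgrp_ab]. *)
Lemma cycle_boundary (z : Zgrp 1) : Lboundary (repr (cycle_val z)) = 0.
Proof.
apply: Dgrp0; rewrite -[Lboundary _]subr0; apply/Dgrp_eqP.
by rewrite raddf0; apply/eqP; apply: (cycleP z).
Qed.

End HomologyClasses.

(** * Choice of the paths from the base point, and the isomorphism *)

Lemma connected_tethers (R : realType) (X : metricType R) (r : {posnum R})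
    (p : X) : connected_at_scale X r ->
  exists g : X -> seq X, [/\ forall x, path (near_at r) p (g x),
    forall x, last p (g x) = x & g p = [::]].
Proof.
move=> hX; have /choice[g gP] (x : X) : exists s : seq X,
    [/\ path (near_at r) p s, last p s = x & x = p -> s = [::]].
  (* The base point gets the empty path, since an r-path from p to p given by connectedness could be
     a nontrivial loop. *)
  have [->|xp] := eqVneq x p; first by exists [::].
  have [[//|y s] /and3P[/andP[_ /= ps] /eqP yp /eqP sx]] := hX p x.
  exists s; move: ps sx; rewrite yp => ps sx; split=> //.
  by move=> xp'; rewrite xp' eqxx in xp.
by exists g; split=> [x|x|]; [case: (gP x)|case: (gP x)|case: (gP p) => _ _ ->].
Qed.

Theorem theorem1p2 (R : realType) (X : metricType R) (r : {posnum R})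
    (hX : connected_at_scale X r) (p : X) :
  exists f : DH X r 1 -> abelianization (A1 r p),
    bijective f /\ {morph f : x y / (x + y) >-> (x * y)%g}.
Proof.
have [g [g_path g_last g_base]] := connected_tethers p hX.
pose f (u : DH X r 1) : abelianization (A1 r p) := Q1_ab p g (DHtoQ u).
(* Up to the embedding [DHtoQ], the map [ab_chain] is a left inverse of [f]. *)
have fK u : ab_chain (f u) = DHtoQ u.
  rewrite /f /DHtoQ Q1_ab_toQ// ab_chain_Lgrp_ab// cycle_boundary.
  by rewrite raddf0 addr0.
have f_surj a : exists u, f u = a.
  (* Two layers of representatives lead from the abelianization to a loop, whose chain is the
     required cycle. *)
  rewrite -[a]reprK -[repr a]reprK; set s := repr (repr a).
  have cyc : \pi_(Cgrp X r 1) (chain r p s) \in @cycle_pred _ X r 1.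
    rewrite unfold_in boundary_pi; have [s' [-> _ ps sp]] := loop_consP s.
    by rewrite chain_boundary//= sp subrr raddf0.
  exists (\pi_(DH X r 1) (Cycle cyc)).
  by rewrite /f DHtoQ_pi CtoQ_pi Q1_ab_toQ// Lgrp_ab_chain.
have [h hK] := choice f_surj.
exists f; split.
  (* By choice [h] is a right inverse; it is also a left inverse because [fK] and the injectivity of
     [DHtoQ] make [f] injective. *)
  exists h => // u; apply: (@DHtoQ_inj _ X r).
  by rewrite -!fK hK.
by move=> u v; rewrite /f DHtoQD Q1_abD.
Qed.
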